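(* Let $(X,d,\omega)$ be an unbounded complete $2$-PI space, let $\pi$ be a positive Radon measure on $X$, and let $B=B(x,r)$ be a ball satisfying $0<\omega(B),\pi(B)<\infty$ and $r^2\pi(B)\simeq\omega(B)$. Then for every $u\in N^{1,2}_{\mathrm{loc}}(X)$, $$\omega(B)\int_B|\widetilde u-u_{B,\omega}|^2\,d\pi\le\mathcal O_{\omega,\pi}(u;B)\le2\omega(B)\int_B|\widetilde u-u_{B,\omega}|^2\,d\pi+C\omega(B)\int_{\lambda_2B}g_u^2\,d\omega,$$ where $C$ depends only on the $2$-PI data and the comparability constants in $r^2\pi(B)\simeq\omega(B)$.
   Context: Balls are open and carry a designated centre and radius; $\lambda B$ is the concentric ball with radius multiplied by $\lambda$; $r_B$ is the radius of $B$; $u_{B,\omega}=\frac1{\omega(B)}\int_B u\,d\omega$. The measure $\omega$ is a Borel regular measure with full support on the metric space $(X,d)$. $2$-PI space: $\omega$ is doubling, i.e. $0<\omega(B(x,2r))\le C_D\,\omega(B(x,r))<\infty$ for all $x\in X$, $r>0$, and there are $C_P>0$, $\lambda_P\ge1$ such that $$\frac1{\omega(B)}\int_B|u-u_{B,\omega}|\,d\omega\le C_P r_B\Big(\frac1{\omega(\lambda_PB)}\int_{\lambda_PB}g^2\,d\omega\Big)^{1/2}$$ for every ball $B$, every locally integrable $u$ and every $2$-weak upper gradient $g$ of $u$. $N^{1,2}_{\mathrm{loc}}(X)$ is the local Newtonian Sobolev space, $g_u$ the minimal $2$-weak upper gradient of $u$, and $\widetilde u$ a fixed quasicontinuous representative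 of $u$ (assumed $\pi$-measurable so that the integrals make sense). The mixed oscillation is $$\mathcal O_{\omega,\pi}(u;B)=\int_B\int_B|u(x)-\widetilde u(y)|^2\,d\omega(x)\,d\pi(y).$$ $\lambda_2\ge1$ is a constant depending only on the $2$-PI data $C_D,C_P,\lambda_P$ for which $\int_B|u-u_{B,\omega}|^2\,d\omega\le C_2'r_B^2\int_{\lambda_2B}g_u^2\,d\omega$ for all balls $B$ and all $u\in N^{1,2}_{\mathrm{loc}}(X)$. Integrals take values in $[0,\infty]$. *)

(* Defs.v *)
From HB Require Import structures.
From mathcomp Require Import all_boot all_order all_algebra.
From mathcomp Require Import all_classical all_reals all_analysis.
From mathcomp Require Import measurable_realfun.

Set Implicit Arguments.
Unset Strict Implicit.
Unset Printing Implicit Defensive.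
Import Order.TTheory GRing.Theory Num.Theory.

Local Open Scope classical_set_scope.
Local Open Scope ring_scope.

#[short(type="completeMetricType")]
HB.structure Definition CompleteMetric (K : numFieldType) :=
  { T of Complete T & Metric K T }.

Section measures.
Context {R : realType} {X : completeMetricType R}.
Implicit Type mu : {outer_measure set X -> \bar R}.

(* Measures are outer measures on X; integration and measurability of functions
   are with respect to the (complete) Caratheodory sigma-algebra. *)
Definition cara mu : {measure set (caratheodory_type mu) -> \bar R} :=
  (mu : set (caratheodory_type mu) -> \bar R).

Definition mu_measurable mu (D : set X) (f : X -> \bar R) : Prop :=
  measurable_fun (D : set (caratheodory_type mu))
                 (f : caratheodory_type mu -> \bar R).

Definition borel_fun (f : X -> \bar R) : Prop :=
  measurable_fun setT (f : g_sigma_algebraType (@open X) -> \bar R).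

Definition borel_regular mu : Prop :=
  (forall U : set X, open U -> mu.-caratheodory U) /\
  (forall A : set X, exists B : set X,
     [/\ <<s (@open X) >> B, A `<=` B & mu B = mu A]).

Record radon mu : Prop := {
  radon_borel_regular : borel_regular mu ;
  radon_compact : forall K : set X, compact K -> (mu K < +oo)%E ;
  radon_inner : forall U : set X, open U ->
    mu U = ereal_sup [set mu K | K in [set K | compact K /\ K `<=` U]] ;
  radon_outer : forall A : set X,
    mu A = ereal_inf [set mu U | U in [set U | open U /\ A `<=` U]] }.

Definition average mu (B : set X) (u : X -> \bar R) : \bar R :=
  (((fine (mu B))^-1)%:E * \int[cara mu]_(x in B) u x)%E.

Definition locally_integrable_fun mu (u : X -> \bar R) : Prop :=
  mu_measurable mu setT u /\
  forall x, exists2 r : R, 0 < r &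
    (\int[cara mu]_(y in ball x r) `|u y| < +oo)%E.

Definition L2loc mu (g : X -> \bar R) : Prop :=
  mu_measurable mu setT g /\
  forall x, exists2 r : R, 0 < r &
    (\int[cara mu]_(y in ball x r) `|g y| ^+ 2 < +oo)%E.

End measures.

Section curves.
Context {R : realType} {X : completeMetricType R}.

Definition curve_length (gam : R -> X) (a b : R) : \bar R :=
  ereal_sup [set (\sum_(0 <= i < size s)
                    mdist (gam (nth b (a :: s) i))
                          (gam (nth b (a :: s) i.+1)))%:E
            | s in itv_partition a b].

(* Nonconstant compact rectifiable curves, parametrized by arc length on
   [0, len]; the values of the map outside [0, len] are irrelevant. *)
Record curve := Curve {
  len : R ;
  cpath :> R -> X ;
  len_gt0 : 0 < len ;
  arclength : forall s t, 0 <= s -> s <= t -> t <= len ->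
    curve_length cpath s t = (t - s)%:E }.

Definition curve_in (D : set X) (c : curve) : Prop :=
  forall t, 0 <= t -> t <= len c -> D (c t).

Definition line_integral (c : curve) (rho : X -> \bar R) : \bar R :=
  (\int[lebesgue_measure]_(t in `[0%R, len c]) rho (c t))%E.

End curves.
Arguments curve {R} X.

Section newtonian.
Context {R : realType} {X : completeMetricType R}.
Variable omega : {outer_measure set X -> \bar R}.
Implicit Types (D E G : set X) (u v g h : X -> \bar R).
Local Open Scope ereal_scope.

Definition modulus2 (Gam : set (curve X)) : \bar R :=
  ereal_inf [set \int[cara omega]_x rho x ^+ 2 | rho in
    [set rho : X -> \bar R | [/\ (forall x, 0 <= rho x), borel_fun rho &
      forall c, Gam c -> 1 <= line_integral c rho]]].

(* If u takes the same infinite value at both end points then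
   `|u _ - u _| = +oo, which is the usual convention here. For g that is merely
   omega-measurable, g is measurable along 2-almost every curve, so that
   line_integral is a genuine integral for all but a negligible family. *)
Definition weak_upper_gradient D u g : Prop :=
  [/\ mu_measurable omega D g, (forall x, 0 <= g x) &
      modulus2 [set c | curve_in D c /\
        ~ (`|u (c 0%R) - u (c (len c))| <= line_integral c g)] = 0].

(* squared norm of N^{1,2}(D), for D open *)
Definition newtonian_sqnorm D u : \bar R :=
  \int[cara omega]_(x in D) `|u x| ^+ 2 +
  ereal_inf [set \int[cara omega]_(x in D) g x ^+ 2
            | g in weak_upper_gradient D u].

Definition N12 D u : Prop :=
  mu_measurable omega D u /\ newtonian_sqnorm D u < +oo.

Definition N12loc u : Prop :=
  mu_measurable omega setT u /\
  forall x, exists2 r : R, (0 < r)%R & N12 (ball x r) u.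

Definition minimal_weak_upper_gradient u g : Prop :=
  [/\ weak_upper_gradient setT u g, L2loc omega g &
      forall h, weak_upper_gradient setT u h -> L2loc omega h ->
        {ae cara omega, forall x, g x <= h x}].

Definition capacity2 E : \bar R :=
  ereal_inf [set newtonian_sqnorm setT v
            | v in [set v | N12 setT v /\ forall x, E x -> 1 <= v x]].

Definition quasicontinuous v : Prop :=
  forall e : R, (0 < e)%R -> exists G,
    [/\ open G, capacity2 G < e%:E, (forall x, ~ G x -> v x \is a fin_num) &
        {within ~` G, continuous v}].

Definition quasicontinuous_representative u v : Prop :=
  quasicontinuous v /\ {ae cara omega, forall x, v x = u x}.

Record PI2_space (CD CP lambdaP : R) : Prop := {
  PI2_borel_regular : borel_regular omega ;
  PI2_full_support : forall U : set X, open U -> U !=set0 -> 0 < omega U ;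
  PI2_doubling : forall (x : X) (r : R), (0 < r)%R ->
    [/\ 0 < omega (ball x (2 * r)%R),
        omega (ball x (2 * r)%R) <= CD%:E * omega (ball x r) &
        CD%:E * omega (ball x r) < +oo] ;
  PI2_CP_gt0 : (0 < CP)%R ;
  PI2_lambdaP_ge1 : (1 <= lambdaP)%R ;
  PI2_poincare : forall (x : X) (r : R) u g, (0 < r)%R ->
    locally_integrable_fun omega u -> weak_upper_gradient setT u g ->
    ((fine (omega (ball x r)))^-1)%:E *
      \int[cara omega]_(y in ball x r) `|u y - average omega (ball x r) u|
    <= (CP * r)%:E *
       sqrte (((fine (omega (ball x (lambdaP * r)%R)))^-1)%:E *
              \int[cara omega]_(y in ball x (lambdaP * r)%R) g y ^+ 2) }.

Definition poincare22 (C lambda : R) : Prop :=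
  forall (x : X) (r : R) u g, (0 < r)%R ->
    N12loc u -> minimal_weak_upper_gradient u g ->
    \int[cara omega]_(y in ball x r) `|u y - average omega (ball x r) u| ^+ 2
    <= (C * r ^+ 2)%:E *
       \int[cara omega]_(y in ball x (lambda * r)%R) g y ^+ 2.

End newtonian.

Definition mixed_oscillation {R : realType} {X : completeMetricType R}
    (omega pi : {outer_measure set X -> \bar R}) (u ut : X -> \bar R)
    (B : set X) : \bar R :=
  (\int[cara pi]_(y in B) \int[cara omega]_(x in B) `|u x - ut y| ^+ 2)%E.

Definition unbounded_space {R : realType} (X : completeMetricType R) : Prop :=
  forall M : R, exists x y : X, M < mdist x y.

(* Main.v *)
(* Write a for the average of u over B. For each fixed y, Jensen's inequality
   gives omega(B) |ut(y) - a|^2 <= \int_B |u - ut(y)|^2 domega, and integrating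
   in y against pi is the lower bound. For the upper bound, integrate
   |u(x) - ut(y)|^2 <= 2 |u(x) - a|^2 + 2 |ut(y) - a|^2; the first term
   contributes 2 pi(B) \int_B |u - a|^2 domega, which the (2,2)-Poincare
   inequality and r^2 pi(B) <= c2 omega(B) bound by the energy term. *)

Require Import Defs.
From HB Require Import structures.
From mathcomp Require Import all_boot all_order all_algebra.
From mathcomp Require Import all_classical all_reals all_analysis.
From mathcomp Require Import measurable_realfun.
From mathcomp Require Import ring lra.

Set Implicit Arguments.
Unset Strict Implicit.
Unset Printing Implicit Defensive.
Import Order.TTheory GRing.Theory Num.Theory.

Local Open Scope classical_set_scope.
Local Open Scope ring_scope.

(** By the triangle inequality the ball of radius [r - mdist x y] about a point [y] of [ball x r]
    stays inside it. This makes balls Caratheodory measurable below. *)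
Lemma open_metric_ball (R : realType) (X : metricType R) (x : X) (r : R) :
  open (ball x r).
Proof.
rewrite openE => y; rewrite ballEmdist /= => xy.
apply/nbhs_ballP; exists (r - mdist x y); first by rewrite /= subr_gt0.
move=> z; rewrite !ballEmdist /= => yz.
by rewrite (le_lt_trans (metric_triangle x y z))// -ltrBrDl.
Qed.

Section ereal.
Context {R : realDomainType}.
Implicit Types x y a : \bar R.
Local Open Scope ereal_scope.

Lemma distre_sym x y : `|x - y| = `|y - x|.
Proof. by move: x y => [x||] [y||] //=; rewrite distrC. Qed.

(* This covers [x = y], because [+oo - +oo = -oo] and [-oo + +oo = -oo]. *)
Lemma sqr_distre_infty x y : y \isn't a fin_num -> `|x - y| ^+ 2 = +oo.
Proof. by case: y => [//||] _; case: x => [x||]. Qed.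

(** If one of [x], [y], [a] is infinite, a term on the right is [+oo]. For finite values the right
    side minus the left is [(x + y - 2 a)^2]. *)
Lemma sqr_distre_le x y a :
  `|x - y| ^+ 2 <= 2%:E * `|x - a| ^+ 2 + 2%:E * `|y - a| ^+ 2.
Proof.
have two z : 0 <= 2%:E * `|z - a| ^+ 2.
  by rewrite mule_ge0 ?sqre_ge0 ?lee_fin.
have two_infty z : (z \isn't a fin_num) || (a \isn't a fin_num) ->
    2%:E * `|z - a| ^+ 2 = +oo.
  case/orP => oo; last by rewrite sqr_distre_infty// gt0_muley ?lte_fin.
  by rewrite distre_sym sqr_distre_infty// gt0_muley ?lte_fin.
have [xa|xa] := boolP ((x \isn't a fin_num) || (a \isn't a fin_num)).
  rewrite (two_infty x)// addye ?leey//.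
  by rewrite -ltNye (lt_le_trans _ (two y)).
have [ya|ya] := boolP ((y \isn't a fin_num) || (a \isn't a fin_num)).
  rewrite (two_infty y)// addey ?leey//.
  by rewrite -ltNye (lt_le_trans _ (two x)).
move: x y a xa ya {two two_infty} => [x||] [y||] [a||] // _ _.
rewrite -!EFinB !abse_EFin -!EFin_expe -!EFinM -EFinD lee_fin !real_normK ?num_real//.
by have := sqr_ge0 (x + y - a - a); nra.
Qed.

End ereal.

Section integral.
Context d (T : measurableType d) (R : realType).
Variable mu : {measure set T -> \bar R}.
Local Open Scope ereal_scope.

(* Unlike [ge0_le_integral], no measurability is required: the partial
   integrals of a function of two variables need not be measurable. *)
Lemma ge0_le_integral_nonmeas (D : set T) (f g : T -> \bar R) :
  (forall x, D x -> 0 <= f x) -> (forall x, D x -> f x <= g x) ->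
  \int[mu]_(x in D) f x <= \int[mu]_(x in D) g x.
Proof.
move=> f0 fg; have g0 x : D x -> 0 <= g x.
  by move=> Dx; apply: le_trans (fg x Dx); exact: f0.
(* Both integrals are suprema over simple functions, and a simple function below [f] is also below
   [g]. *)
rewrite !ge0_integralE//; apply: ereal_sup_le => _ [h /= hf <-]; exists h => //= x.
by apply: le_trans (hf x) _; rewrite /patch; case: ifPn => // /set_mem /fg.
Qed.

Lemma measurable_sqr_distre (D : set T) (f : T -> \bar R) (t : \bar R) :
  measurable_fun D f -> measurable_fun D (fun x => `|f x - t| ^+ 2).
Proof.
move=> mf; have mft : measurable_fun D (fun x => `|f x - t|).
  by apply: measurableT_comp => //; exact: emeasurable_funB.
exact: emeasurable_funM.
Qed.

Variable D : set T.
Hypotheses (mD : measurable D) (D0 : 0 < mu D) (Doo : mu D < +oo).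

(* [W = mu D] and [a] is the average of [f] over [D]: integrate over [D] the
   tangent line inequality [(z - t)^2 >= 2 (a - t) z - (a - t) (a + t)], which is
   [(z - a)^2 >= 0]. If the right-hand side is finite, then [t] is finite and
   [f] is integrable, since [|z| <= |t| + 1 + (z - t)^2]. *)
Lemma sqr_dist_average_le (f : T -> \bar R) (t : \bar R) :
  measurable_fun D f ->
  mu D * `|t - ((fine (mu D))^-1)%:E * \int[mu]_(x in D) f x| ^+ 2
  <= \int[mu]_(x in D) `|f x - t| ^+ 2.
Proof.
move=> mf; have mft := measurable_sqr_distre t mf.
have [->|] := eqVneq (\int[mu]_(x in D) `|f x - t| ^+ 2) +oo; first by rewrite leey.
rewrite -ltey => ftoo.
have : t \is a fin_num.
  apply: contraLR ftoo => tinf; rewrite -leNgt.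
  have ftE x : D x -> `|f x - t| ^+ 2 = +oo.
    by move=> _; exact: sqr_distre_infty.
  rewrite (eq_integral (cst +oo)); last by move=> x /set_mem; exact: ftE.
  by rewrite integral_cst// gt0_mulye.
move: t mft ftoo => [t| |] // mft ftoo _.
have WE : mu D = (fine (mu D))%:E by rewrite fineK// ge0_fin_numE.
set W := fine (mu D) in WE *.
have W0 : (0 < W)%R by rewrite -lte_fin -WE.
have icst c : mu.-integrable D (cst c%:E).
  apply/integrableP; split; first exact: measurable_cst.
  by rewrite /= integral_cst// WE -EFinM ltry.
have ift : mu.-integrable D (fun x => `|f x - t%:E| ^+ 2).
  apply/integrableP; split => //.
  by rewrite (eq_integral (fun x => `|f x - t%:E| ^+ 2)) // => x _; rewrite gee0_abs ?sqre_ge0.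
have intf : mu.-integrable D f.
  apply: (@le_integrable _ _ _ _ _ mD _
    (fun x => (`|t| + 1)%:E + `|f x - t%:E| ^+ 2)) => //; last first.
    by apply: integrableD => //; exact: icst.
  move=> x _; rewrite [leRHS]gee0_abs; last first.
    by rewrite adde_ge0 ?sqre_ge0// lee_fin addr_ge0.
  case: (f x) => [z||] //; rewrite -EFinB !abse_EFin -EFin_expe -EFinD lee_fin.
  rewrite (le_trans (_ : `|z| <= `|t| + `|z - t|)%R) //.
    by rewrite (le_trans _ (ler_normD _ _))// addrC subrK.
  (* With [s = |z - t| >= 0], the square gives [2 s <= 1 + s^2], hence [s <= 1 + s^2]. *)
  rewrite -addrA lerD2l; have := sqr_ge0 (`|z - t| - 1)%R.
  by have := normr_ge0 (z - t)%R; nra.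
have [I IE] : exists I, \int[mu]_(x in D) f x = I%:E.
  exists (fine (\int[mu]_(x in D) f x)); rewrite fineK//.
  exact: integrable_fin_num.
set a := (W^-1 * I)%R.
have IaW : I = (a * W)%R by rewrite /a mulrAC mulVf ?mul1r// gt_eqF.
rewrite IE -EFinM -/a -EFinB abse_EFin -EFin_expe WE -EFinM.
set k := (2 * (a - t))%R; set c := ((a - t) * (a + t))%R.
have ikc : mu.-integrable D (fun x => k%:E * f x - c%:E).
  apply: integrableB => //; last exact: icst.
  exact: integrableZl.
apply: (@le_trans _ _ (\int[mu]_(x in D) (k%:E * f x - c%:E))); last first.
  apply: le_integral => // x _.
  case: (f x) => [z||]; [|exact: leey|exact: leey].
  rewrite -!EFinB abse_EFin -EFin_expe lee_fin real_normK ?num_real//.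
  by rewrite /k /c; have := sqr_ge0 (z - a)%R; nra.
rewrite integralB//; [|exact: integrableZl|exact: icst].
rewrite integralZl// IE IaW integral_cst// WE -!EFinM -EFinB lee_fin.
rewrite real_normK ?num_real//.
(* Equality holds: the line [k z - c] takes the value [(a - t)^2] at the average [a], so its
   integral is [W (a - t)^2]. *)
rewrite le_eqVlt; apply/orP; left; apply/eqP.
by rewrite /k /c; ring.
Qed.

End integral.

Section mixed_integral.
Context d1 d2 (T1 : measurableType d1) (T2 : measurableType d2) (R : realType).
Variables (mu : {measure set T1 -> \bar R}) (nu : {measure set T2 -> \bar R}).
Variables (A : set T1) (B : set T2) (f : T1 -> \bar R) (g : T2 -> \bar R).
Hypotheses (mA : measurable A) (mB : measurable B).
Hypotheses (mf : measurable_fun A f) (mg : measurable_fun B g).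
Local Open Scope ereal_scope.

(** For each [y] this is the bound for a constant [t], taken at [t = g y], once [mu A] is moved
    under the outer integral. *)
Lemma sqr_dist_average_le_mixed (A0 : 0 < mu A) (Aoo : mu A < +oo)
    (a := ((fine (mu A))^-1)%:E * \int[mu]_(x in A) f x) :
  mu A * \int[nu]_(y in B) `|g y - a| ^+ 2
  <= \int[nu]_(y in B) \int[mu]_(x in A) `|f x - g y| ^+ 2.
Proof.
have sq0 (z b : \bar R) : 0 <= `|z - b| ^+ 2 by exact: sqre_ge0.
rewrite -ge0_integralZl//; last exact: measurable_sqr_distre.
apply: ge0_le_integral_nonmeas => y _; first by rewrite mule_ge0.
exact: sqr_dist_average_le.
Qed.

Lemma mixed_sqr_dist_le (a : \bar R) :
  \int[nu]_(y in B) \int[mu]_(x in A) `|f x - g y| ^+ 2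
  <= 2%:E * mu A * \int[nu]_(y in B) `|g y - a| ^+ 2
     + 2%:E * nu B * \int[mu]_(x in A) `|f x - a| ^+ 2.
Proof.
have sq0 (z b : \bar R) : 0 <= `|z - b| ^+ 2 by exact: sqre_ge0.
have inner y : \int[mu]_(x in A) `|f x - g y| ^+ 2
    <= 2%:E * mu A * `|g y - a| ^+ 2
       + 2%:E * \int[mu]_(x in A) `|f x - a| ^+ 2.
  apply: (@le_trans _ _ (\int[mu]_(x in A)
    (cst (2%:E * `|g y - a| ^+ 2) x + 2%:E * `|f x - a| ^+ 2))).
    apply: ge0_le_integral_nonmeas => // x _.
    by rewrite [leRHS]addeC; exact: sqr_distre_le.
  rewrite ge0_integralD//; last first.
  - by apply: measurable_funeM; exact: measurable_sqr_distre.
  - by move=> x _; rewrite mule_ge0.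
  - by move=> x _; rewrite mule_ge0.
  rewrite integral_cst// ge0_integralZl//; last exact: measurable_sqr_distre.
  by rewrite muleAC.
(* From here on the integral in [x] is a constant [E], and integrating it in [y] yields the factor
   [nu B]. *)
have : 0 <= \int[mu]_(x in A) `|f x - a| ^+ 2 by exact: integral_ge0.
move: (\int[mu]_(x in A) `|f x - a| ^+ 2) inner => E inner E0.
apply: (@le_trans _ _ (\int[nu]_(y in B)
    (2%:E * mu A * `|g y - a| ^+ 2 + cst (2%:E * E) y))).
  by apply: ge0_le_integral_nonmeas => y _ //; exact: integral_ge0.
have mga := measurable_sqr_distre a mg.
rewrite ge0_integralD//; last first.
- by move=> y _; rewrite mule_ge0.
- exact: measurable_funeM.
- by move=> y _; rewrite !mule_ge0.
rewrite integral_cst// ge0_integralZl// ?mule_ge0//.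
by rewrite (muleAC _ E).
Qed.

End mixed_integral.

(* lambda2 and C2' are functions of the 2-PI data (CD, CP, lambdaP); C is a
   function of these data and of the comparability constants c1, c2. *)
Theorem proposition4p8 (R : realType) (lambda2 C2' : R -> R -> R -> R) :
  exists C : R -> R -> R -> R -> R -> R,
  forall (CD CP lambdaP c1 c2 : R) (X : completeMetricType R)
         (omega pi : {outer_measure set X -> \bar R}),
  unbounded_space X ->
  PI2_space omega CD CP lambdaP ->
  1 <= lambda2 CD CP lambdaP ->
  poincare22 omega (C2' CD CP lambdaP) (lambda2 CD CP lambdaP) ->
  radon pi ->
  forall (x : X) (r : R), 0 < r ->
  let B := ball x r in
  (0 < omega B < +oo)%E -> (0 < pi B < +oo)%E ->
  0 < c1 -> 0 < c2 ->
  (c1%:E * omega B <= (r ^+ 2)%:E * pi B <= c2%:E * omega B)%E ->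
  forall u ut gu : X -> \bar R,
  N12loc omega u ->
  quasicontinuous_representative omega u ut -> mu_measurable pi setT ut ->
  minimal_weak_upper_gradient omega u gu ->
  let osc := (\int[cara pi]_(y in B) `|ut y - average omega B u| ^+ 2)%E in
  let energy :=
    (\int[cara omega]_(y in ball x (lambda2 CD CP lambdaP * r)%R)
       gu y ^+ 2)%E in
  (omega B * osc <= mixed_oscillation omega pi u ut B)%E /\
  (mixed_oscillation omega pi u ut B <=
     2%:E * omega B * osc +
     (C CD CP lambdaP c1 c2)%:E * omega B * energy)%E.
Proof.
(* The 2 comes from [sqr_distre_le], [C2'] from the Poincare inequality and [c2] from
   [r^2 pi(B) <= c2 omega(B)]. The absolute value makes the factor nonnegative whatever the sign of
   [C2']. *)
exists (fun CD CP lambdaP _ c2 => 2 * `|C2' CD CP lambdaP| * c2).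
move=> CD CP lambdaP c1 c2 X omega pi _ PI _ poin Hpi x r r0 B.
move=> /andP[oB0 oBoo] /andP[pB0 pBoo] c10 c20 /andP[_ c2B] u ut gu Hu _ mut Hg.
move=> osc energy.
have mBo : measurable (B : set (caratheodory_type omega)).
  exact: (PI2_borel_regular PI).1 (open_metric_ball x r).
have mBp : measurable (B : set (caratheodory_type pi)).
  exact: (radon_borel_regular Hpi).1 (open_metric_ball x r).
have mu : measurable_fun (B : set (caratheodory_type omega))
    (u : caratheodory_type omega -> \bar R).
  by apply: measurable_funS Hu.1.
have mutB : measurable_fun (B : set (caratheodory_type pi))
    (ut : caratheodory_type pi -> \bar R).
  by apply: measurable_funS mut.
split.
  exact: (@sqr_dist_average_le_mixed _ _ _ _ _ (cara omega) (cara pi)).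
apply: le_trans (@mixed_sqr_dist_le _ _ _ _ _ (cara omega) (cara pi) _ _ _ _
  mBo mBp mu mutB (average omega B u)) _.
(* The [osc] terms agree, which leaves the term in [u] alone to be bounded by the energy. *)
apply: leeD => //.
have en0 : (0 <= energy)%E by apply: integral_ge0 => z _; exact: sqre_ge0.
have := poin x _ _ _ r0 Hu Hg; rewrite -/B -/energy.
move: energy en0 => energy en0 poinB.
have pB_ge0 := ltW pB0.
set K := `|C2' CD CP lambdaP|.
apply: (@le_trans _ _ (2%:E * pi B * ((K * r ^+ 2)%:E * energy))%E).
  rewrite lee_wpmul2l ?mule_ge0//; apply: (le_trans poinB).
  by rewrite lee_wpmul2r// lee_fin ler_wpM2r ?sqr_ge0// ler_norm.
(* The factor [r^2] from Poincare is grouped with [pi B], so that comparability applies. *)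
rewrite [leLHS](_ : _ = (2 * K)%:E * ((r ^+ 2)%:E * pi B) * energy)%E; last first.
  by rewrite !EFinM muleA muleACA (muleC (pi B)) !muleA.
rewrite (EFinM (2 * K)) lee_wpmul2r// -[leRHS]muleA lee_wpmul2l// lee_fin.
by rewrite mulr_ge0// normr_ge0.
Qed.
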